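(* Let $X$ be a nonempty compact metrizable space and let $f:X\to X$ be an arbitrary map (no continuity or other regularity is assumed). Then the set $CR_f=\{x\in X : x\,\mathcal{C}\,x\}$ of chain-recurrent points of $(X,f)$ is nonempty.
   Context: A compact dynamical system is a pair $(X,f)$ with $X$ a compact metrizable space and $f:X\to X$ an arbitrary self-map. Fix a metric $d$ compatible with the topology of $X$. For $x,y\in X$ and $\epsilon>0$, an $\epsilon$-chain from $x$ to $y$ is a finite sequence $x_0,x_1,\dots,x_n$ of points of $X$, with $n\ge 1$, such that $x_0=x$, $x_n=y$ and $d(f(x_i),x_{i+1})<\epsilon$ for every $i=0,\dots,n-1$. The chain relation is defined by: $x\,\mathcal{C}\,y$ iff for every $\epsilon>0$ there exists an $\epsilon$-chain from $x$ to $y$. (Since $X$ is compact, $\mathcal{C}$ does not depend on the choice of the compatible metric $d$.) A point $x$ is chain-recurrent if $x\,\mathcal{C}\,x$. *)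

(* Defs.v *)
From mathcomp Require Import all_boot all_order all_algebra.
From mathcomp Require Import all_classical all_reals.
From mathcomp Require Import topology.

Set Implicit Arguments.
Unset Strict Implicit.
Unset Printing Implicit Defensive.

Local Open Scope classical_set_scope.
Local Open Scope ring_scope.

(* The chain x_0, ..., x_n is the sequence x :: s, so that n = size s. *)
Definition epsilon_chain (R : realType) (X : metricType R) (f : X -> X)
    (e : R) (x y : X) (s : seq X) : Prop :=
  [/\ (1 <= size s)%N,
      last x s = y &
      path (fun a b : X => mdist (f a) b < e) x s].

Definition chain_rel (R : realType) (X : metricType R) (f : X -> X)
    (x y : X) : Prop :=
  forall e : R, 0 < e -> exists s : seq X, epsilon_chain f e x y s.

Definition chain_recurrent (R : realType) (X : metricType R) (f : X -> X)
    : set X :=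
  [set x | chain_rel f x x].

(* Main.v *)
Require Import Defs.
From mathcomp Require Import all_boot all_order all_algebra.
From mathcomp Require Import all_classical all_reals.
From mathcomp Require Import topology.

(** Without continuity of [f], the forward chain sets [C(x) = {y | x C y}] are
    still closed and contain [f x], and [C] is transitive. By compactness a
    family of points whose chain sets are nested has a point in all of them, so
    Zorn's lemma yields [t] with [C(t)] minimal. As [f t] is in [C(t)],
    minimality gives [C(f t) = C(t)], which contains [f t]. *)

Import Order.TTheory GRing.Theory Num.Theory.
Local Open Scope classical_set_scope.
Local Open Scope ring_scope.

Lemma chain_rel_map (R : realType) (X : metricType R) (f : X -> X) (x : X) :
  chain_rel f x (f x).
Proof. by move=> e e0; exists [:: f x]; split=> //=; rewrite mdistxx e0. Qed.

Lemma chain_rel_trans (R : realType) (X : metricType R) (f : X -> X)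
    (y x z : X) :
  chain_rel f x y -> chain_rel f y z -> chain_rel f x z.
Proof.
move=> xy yz e e0.
have [s [s1 lasts paths]] := xy e e0; have [t [t1 lastt patht]] := yz e e0.
exists (s ++ t); split; first by rewrite size_cat ltn_addr.
  by rewrite last_cat lasts.
by rewrite cat_path paths lasts.
Qed.

(** An [e / 2]-chain ending at some [z] within [e / 2] of [y] becomes an [e]-chain to [y] by moving
    only its last point. [f] is never applied to that point, so continuity does not enter. *)
Lemma closed_chain_rel (R : realType) (X : metricType R) (f : X -> X) (x : X) :
  closed [set y | chain_rel f x y].
Proof.
move=> y cly e e0; have e20 : 0 < e / 2 by rewrite divr_gt0.
have [z [/= /(_ _ e20)]] := cly _ (nbhsx_ballx y _ e20).
rewrite ballEmdist => -[s [+ + +]] /= yz.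
case/lastP: s => [//|s w] _; rewrite last_rcons rcons_path => -> /andP[ps pz].
exists (rcons s y); split; rewrite ?size_rcons ?last_rcons// rcons_path.
apply/andP; split.
  by apply: sub_path ps => a b /lt_trans; apply; rewrite gtr_pMr// invf_lt1// ltr1n.
rewrite (le_lt_trans (metric_triangle _ z _))// [e]splitr ltrD//.
by rewrite metric_sym.
Qed.

(** Nestedness makes the [B i] a filter base; a cluster point of the filter lies in every [B i], as
    these are closed. *)
Lemma compact_total_bigcap (I : Type) (T : topologicalType) (A : set I)
    (B : I -> set T) :
  compact [set: T] -> A !=set0 ->
  (forall i, A i -> closed (B i)) -> (forall i, A i -> B i !=set0) ->
  total_on A (fun i j => B i `<=` B j) -> \bigcap_(i in A) B i !=set0.
Proof.
move=> cT A0 clB B0 totB.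
have FF : ProperFilter (filter_from A B).
  apply: filter_from_proper => //; apply: filter_from_filter => // i j Ai Aj.
  have [ij|ji] := totB i j Ai Aj; first by exists i => // x Bx; split=> //; exact: ij.
  by exists j => // x Bx; split=> //; exact: ji.
have [p [_ clp]] := cT _ FF filterT.
by exists p => i Ai; apply: clB => // N pN; apply: clp => //; exists i.
Qed.

Theorem theorem3p1 (R : realType) (X : metricType R)
    (X_nonempty : [set: X] !=set0) (X_compact : compact [set: X])
    (f : X -> X) :
  chain_recurrent f !=set0.
Proof.
have [x0 _] := X_nonempty.
pose C x := [set y | chain_rel f x y].
(* Inclusion is reversed so that a Zorn-maximal point has a minimal chain set. *)
pose le x y := `[< C y `<=` C x >].
have lexx x : le x x by apply/asboolP.
have le_tr x y z : le x y -> le y z -> le x z.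
  by move=> /asboolP xy /asboolP yz; apply/asboolP => w /yz /xy.
have [A totA|t maxt] := ZL_preorder x0 lexx le_tr.
  have [->|/set0P A0] := eqVneq A set0; first by exists x0.
  have [|||p Cp] := @compact_total_bigcap _ _ _ C X_compact A0.
  - by move=> x _; exact: closed_chain_rel.
  - by move=> x _; exists (f x); exact: chain_rel_map.
  - by move=> x y Ax Ay; have [/asboolP|/asboolP] := totA x y Ax Ay; [right|left].
  (* Since [p] lies in [C x], transitivity puts [C p] inside [C x]: [p] is an upper bound of [A]. *)
  by exists p => x Ax; apply/asboolP => y; apply: chain_rel_trans; exact: Cp.
exists (f t).
have : le t (f t).
  by apply/asboolP => y; apply: chain_rel_trans; exact: chain_rel_map.
by move=> /maxt /asboolP; apply; exact: chain_rel_map.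
Qed.
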